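(* Let $\delta\in(0,\varepsilon]$ and $\beta\in(0,1]$. Suppose that $\theta^{(1)},\dots,\theta^{(N)}$ are independent and identically distributed realizations drawn from $\mathbb{P}$, that $\mathcal{D}^{(1)},\dots,\mathcal{D}^{(K)}$ is a (known) partition of $\mathcal{D}\supseteq\Theta$ in the sense described in the context, that $$N\ \geq\ \frac{K\log 2+\log\frac1\beta}{2\delta^2},$$ and that there are constants $L_\theta,L_x>0$ such that $$|J(x,\theta_1)-J(x,\theta_2)|\leq L_\theta\|\theta_1-\theta_2\|_q\quad\forall x\in\mathcal{X},\ \forall\theta_1,\theta_2\in\mathcal{D},$$ $$|J(x_1,\theta)-J(x_2,\theta)|\leq L_x\|x_1-x_2\|_2\quad\forall\theta\in\mathcal{D},\ \forall x_1,x_2\in\mathcal{X}.$$ Let $D=\max_{\theta_1,\theta_2\in\mathcal{D}}\|\theta_1-\theta_2\|_q$, $R=\max_{x_1,x_2\in\mathcal{X}}\|x_1-x_2\|_2$, and choose $r\in(0,R]$. Define $$c_1=\sqrt{\frac{L_\theta^2D^2}{2N}\Big(\log\frac1\beta+n_x\log\frac{3R}{r}\Big)},\qquad c_2=2L_xr,\qquad c_3=\frac1N\sum_{j=1}^K\sum_{i\in\mathcal{C}^{(j)}}L_\theta\|\hat\theta^{(j)}-\theta^{(i)}\|_q,$$ and $c=c_1+c_2+c_3$. Then $$\mathbb{P}^N\left(J^\star_{\mathrm{RP}_{\varepsilon+\delta}}-c\ \leq\ J^\star_{\mathrm{CP}_\varepsilon}\ \leq\ J^\star_{\mathrm{PP}_{\varepsilon-\delta}}+c\right)\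 \geq\ 1-3\beta.$$
   Context: Setting. $\mathcal{X}\subset\mathbb{R}^{n_x}$, $\Theta\subset\mathbb{R}^{n_\theta}$, and $(\Theta,\mathfrak{B}(\Theta),\mathbb{P})$ is a probability space (Borel $\sigma$-algebra); $\theta$ is a random variable with law $\mathbb{P}$, and $\Pr$, $\mathbb{E}$ are taken with respect to $\theta\sim\mathbb{P}$. $\mathbb{P}^N$ is the product measure, i.e. the law of the $N$ i.i.d. samples $(\theta^{(1)},\dots,\theta^{(N)})$. $\varepsilon\in[0,1)$ is the risk parameter, $N,K,Z$ are positive integers, and $\|\cdot\|_q$ is a given $q$-norm on $\mathbb{R}^{n_\theta}$. Partition. $\mathcal{D}\subset\mathbb{R}^{n_\theta}$ satisfies $\Theta\subseteq\mathcal{D}$, and $\mathcal{D}^{(1)},\dots,\mathcal{D}^{(K)}\subseteq\mathcal{D}$ are non-empty sets with $\bigcup_{j=1}^K\mathcal{D}^{(j)}=\mathcal{D}$ and $\Pr(\theta\in\mathcal{D}^{(i)}\cap\mathcal{D}^{(j)})=0$ for $i\neq j$. Cost and constraint functions. $J:\mathcal{X}\times\mathcal{D}\to\mathbb{R}_{\geq0}$ is measurable; $g(x,\theta)=\min_{h\in\{1,\dots,Z\}}g_h(x,\theta)$ with $g_h:\mathcal{X}\times\mathcal{D}\to\mathbb{R}$ measurable. Empirical quantities. $\mathcal{C}^{(j)}=\{i\in\{1,\dots,N\}:\theta^{(i)}\in\mathcal{D}^{(j)}\}$ and $\hat p^{(j)}=|\mathcal{C}^{(j)}|/N$ for $j=1,\dots,K$.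 For each $j$ a representative element $\hat\theta^{(j)}\in\mathcal{D}$ for $\mathcal{D}^{(j)}$ is selected; the choice is free and may depend on the samples (e.g. the average of the samples lying in $\mathcal{D}^{(j)}$). Problems and optimal values ($\mathbf{1}_{[X]}$ is 1 if the statement $X$ holds and 0 otherwise; $J^\star$ with a subscript denotes the optimal value of the corresponding minimization problem): - $\mathrm{CP}_\varepsilon$: minimize $\mathbb{E}[J(x,\theta)]$ over $x\in\mathcal{X}$ subject to $\Pr(g(x,\theta)\leq 0)\geq 1-\varepsilon$. - $\mathrm{PP}_\alpha$: minimize $\sum_{j=1}^K\hat p^{(j)}J(x,\hat\theta^{(j)})$ over $x\in\mathcal{X}$ subject to $\sum_{j=1}^K\hat p^{(j)}\,\mathbf{1}_{[\bigvee_{h=1}^Z(g_h(x,\theta)\leq 0\ \forall\theta\in\mathcal{D}^{(j)})]}\geq 1-\alpha$. - $\mathrm{RP}_\alpha$: minimize $\sum_{j=1}^K\hat p^{(j)}J(x,\hat\theta^{(j)})$ over $x\in\mathcal{X}$ subject to $\sum_{j=1}^K\hat p^{(j)}\,\mathbf{1}_{[\bigvee_{h=1}^Z(g_h(x,\hat\theta^{(j)})\leq\gamma_h^{(j)}(x,\hat\theta^{(j)}))]}\geq 1-\alpha$, where the functions $\gamma_h^{(j)}:\mathcal{X}\times\mathcal{D}\to\mathbb{R}_{\geq0}$ satisfy, for all $j\in\{1,\dots,K\}$ and $h\in\{1,\dots,Z\}$, $g_h(x,\hat\theta^{(j)})-g_h(x,\theta)\leq\gamma_h^{(j)}(x,\hat\theta^{(j)})$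 for all $x\in\mathcal{X}$, $\theta\in\mathcal{D}^{(j)}$. *)

(* Defs.v *)
From HB Require Import structures.
From mathcomp Require Import all_boot all_order all_algebra.
From mathcomp Require Import all_classical all_reals all_analysis.
Set Implicit Arguments.
Unset Strict Implicit.
Unset Printing Implicit Defensive.
Import Order.TTheory GRing.Theory Num.Theory.
Import numFieldNormedType.Exports.
Local Open Scope classical_set_scope.
Local Open Scope ring_scope.

(* The case -oo is junk; the norms of interest are those with 1 <= q. *)
Definition qnorm (R : realType) (n : nat) (q : \bar R) (v : 'rV[R]_n) : R :=
  match q with
  | r%:E => (\sum_(i < n) `|v 0 i| `^ r) `^ r^-1
  | _ => \big[Num.max/0]_(i < n) `|v 0 i|
  end.

Definition distances (R : realType) (n : nat) (q : \bar R) (A : set 'rV[R]_n) :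
    set R :=
  [set d | exists x y, [/\ A x, A y & d = qnorm q (x - y)]].

Definition is_maximum (R : realType) (A : set R) (m : R) : Prop :=
  A m /\ ubound A m.

Definition borel_rV (R : realType) (n : nat) : Type :=
  g_sigma_algebraType (@open 'rV[R]_n).
HB.instance Definition _ (R : realType) (n : nat) :=
  Measurable.on (borel_rV R n).

(* Measurable types are pointed in the library, hence the nonemptiness proof. *)
Definition pointed_sub (R : realType) (n : nat) (A : set 'rV[R]_n)
  (A0 : A !=set0) : Type := A.
HB.instance Definition _ (R : realType) (n : nat) (A : set 'rV[R]_n)
  (A0 : A !=set0) := Choice.copy (pointed_sub A0) A.
HB.instance Definition _ (R : realType) (n : nat) (A : set 'rV[R]_n)
    (A0 : A !=set0) :=
  isPointed.Build (pointed_sub A0) (SigSub (mem_set (projT2 (cid A0)))).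

Definition sub_val (R : realType) (n : nat) (A : set 'rV[R]_n)
  (A0 : A !=set0) (a : pointed_sub A0) : borel_rV R n := sval a.

(* A with its Borel sigma-algebra, i.e., the trace on A of that of R^n. *)
Definition borel_sub (R : realType) (n : nat) (A : set 'rV[R]_n)
  (A0 : A !=set0) : Type := g_sigma_algebra_preimageType (@sub_val R n A A0).
HB.instance Definition _ (R : realType) (n : nat) (A : set 'rV[R]_n)
  (A0 : A !=set0) := Measurable.on (borel_sub A0).

Definition point_of (R : realType) (n : nat) (A : set 'rV[R]_n)
  (A0 : A !=set0) (a : borel_sub A0) : 'rV[R]_n := sval a.

Definition incl (R : realType) (n : nat) (A B : set 'rV[R]_n)
    (A0 : A !=set0) (AB : A `<=` B) (a : borel_sub A0) : B :=
  SigSub (mem_set (AB _ (set_mem (svalP a)))).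

(* Joint measurability on A x B for the trace of the Borel sigma-algebra of
   R^m x R^n.  The library's measurable_fun (A `*` B) is not used because it
   holds vacuously when A `*` B is not measurable. *)
Definition measurable2 (R : realType) (m n : nat) (A : set 'rV[R]_m)
    (B : set 'rV[R]_n) (f : A -> B -> R) : Prop :=
  forall Y : set R, measurable Y ->
    preimage_set_system [set: A * B]
      (fun z => (val z.1 : borel_rV R m, val z.2 : borel_rV R n))
      measurable [set z | Y (f z.1 z.2)].

Definition tuple_cons d (T : measurableType d) (n : nat)
    (z : T * n.-tuple T) : n.+1.-tuple T := [tuple of z.1 :: z.2].

Lemma measurable_tuple_cons d (T : measurableType d) (n : nat) :
  measurable_fun [set: T * n.-tuple T] (@tuple_cons d T n).
Proof. exact: measurable_cons. Qed.

HB.instance Definition _ d (T : measurableType d) (n : nat) :=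
  isMeasurableFun.Build _ _ _ _ (@tuple_cons d T n)
    (@measurable_tuple_cons d T n).

(* The n-fold product of P. *)
Fixpoint iid_law d (T : measurableType d) (R : realType)
    (P : probability T R) (n : nat) : probability (n.-tuple T) R :=
  match n with
  | 0 => \d_ ([tuple] : 0.-tuple T)
  | m.+1 => distribution (P \x iid_law P m)%E (@tuple_cons d T m)
  end.

Lemma iid_lawE d (T : measurableType d) (R : realType)
    (P : probability T R) (n : nat) (B : 'I_n -> set T) :
  (forall i, measurable (B i)) ->
  iid_law P n [set s | forall i, B i (tnth s i)] = (\prod_(i < n) P (B i))%E.
Proof.
elim: n B => [|n IH] B mB.
  by rewrite big_ord0 /= diracE mem_set// => -[].
rewrite big_ord_recl /= /distribution /pushforward /=.
rewrite -IH; last by move=> i; exact: mB.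
rewrite -product_measure1E//; last first.
  rewrite [X in measurable X](_ : _ =
    \bigcap_(i in [set: 'I_n]) ((@tnth n T)^~ i @^-1` B (lift ord0 i))).
    apply: fin_bigcap_measurable => // i _.
    by rewrite -[X in measurable X]setTI; exact: measurable_tnth.
  by apply/seteqP; split => s /= h i; [move=> _; exact: (h i)|exact: (h i Logic.I)].
congr product_measure1; apply/seteqP; split => -[t s] /=.
  by move=> h; split => [|i]; [exact: (h ord0)|have := h (lift ord0 i); rewrite tnthS].
move=> [h0 h] i; have [j ->|->] := unliftP ord0 i; last exact: h0.
by rewrite tnthS; exact: h.
Qed.

Definition min_constraint (R : realType) (X D : Type) (Z : nat) (Z0 : (0 < Z)%N)
    (g : 'I_Z -> X -> D -> R) (x : X) (t : D) : R :=
  \big[Num.min/g (Ordinal Z0) x t]_(h < Z) g h x t.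

Definition cell (R : realType) (n N K : nat) (Theta : set 'rV[R]_n)
    (Theta0 : Theta !=set0) (Dj : 'I_K -> set 'rV[R]_n)
    (s : N.-tuple (borel_sub Theta0)) (j : 'I_K) : {set 'I_N} :=
  [set i | point_of (tnth s i) \in Dj j].

Definition phat (R : realType) (n N K : nat) (Theta : set 'rV[R]_n)
    (Theta0 : Theta !=set0) (Dj : 'I_K -> set 'rV[R]_n)
    (s : N.-tuple (borel_sub Theta0)) (j : 'I_K) : R :=
  #|cell Dj s j|%:R / N%:R.

(* The optimal values are infima in the extended reals, equal to +oo when the
   problem is infeasible. *)

Definition CP_value (R : realType) (X : Type) (n : nat)
    (Theta D : set 'rV[R]_n) (Theta0 : Theta !=set0) (ThetaD : Theta `<=` D)
    (P : probability (borel_sub Theta0) R) (J g : X -> D -> R) (eps : R) :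
    \bar R :=
  ereal_inf [set 'E_P[fun t => J x (incl ThetaD t)]%E | x in
    [set x | (P [set t | (g x (incl ThetaD t) <= 0)%R] >= (1 - eps)%:E)%E]].

(* In PP_value and RP_value, p j and that j are the empirical probability and
   the representative of the cell D^(j). *)
Definition PP_value (R : realType) (X : Type) (n K Z : nat)
    (D : set 'rV[R]_n) (Dj : 'I_K -> set 'rV[R]_n) (J : X -> D -> R)
    (g : 'I_Z -> X -> D -> R) (p : 'I_K -> R) (that : 'I_K -> D) (alpha : R) :
    \bar R :=
  ereal_inf [set (\sum_(j < K) p j * J x (that j))%:E | x in
    [set x | \sum_(j < K) p j *
      `[< exists h, forall t : D, Dj j (val t) -> g h x t <= 0 >]%:R
      >= 1 - alpha]].

Definition RP_value (R : realType) (X : Type) (n K Z : nat)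
    (D : set 'rV[R]_n) (gamma : 'I_K -> 'I_Z -> X -> D -> R) (J : X -> D -> R)
    (g : 'I_Z -> X -> D -> R) (p : 'I_K -> R) (that : 'I_K -> D) (alpha : R) :
    \bar R :=
  ereal_inf [set (\sum_(j < K) p j * J x (that j))%:E | x in
    [set x | \sum_(j < K) p j *
      `[< exists h, g h x (that j) <= gamma j h x (that j) >]%:R
      >= 1 - alpha]].

Definition c1 (R : realType) (Lt diam beta Rx r : R) (nx N : nat) : R :=
  Num.sqrt (Lt ^+ 2 * diam ^+ 2 / (2 * N%:R)
            * (ln (beta^-1) + nx%:R * ln (3 * Rx / r))).

Definition c2 (R : realType) (Lx r : R) : R := 2 * Lx * r.

Definition c3 (R : realType) (q : \bar R) (Lt : R) (n N K : nat)
    (Theta D : set 'rV[R]_n) (Theta0 : Theta !=set0)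
    (Dj : 'I_K -> set 'rV[R]_n) (s : N.-tuple (borel_sub Theta0))
    (that : 'I_K -> D) : R :=
  N%:R^-1 * \sum_(j < K) \sum_(i in cell Dj s j)
    Lt * qnorm q (val (that j) - point_of (tnth s i)).

(* Main.v *)
(* With probability at least 1 - beta every union of cells has empirical
   frequency at most delta above its probability (Hoeffding and a union bound
   over the 2^K unions); applied to the cells where a constraint is certified,
   respectively to the complementary cells, this makes feasible points of PP
   feasible for CP, respectively feasible points of CP feasible for RP.  Only
   this upper bound is needed, so the two remaining beta pay for the two-sided
   uniform deviation of the empirical cost, obtained from Hoeffding on an r-net
   of X with at most (3 R / r)^nx points.  The net is bounded without volumes:
   k separated points inside a set of diameter d can be iterated self-similarly
   into k^m separated points at scale (1 + d/r)^m, and counting those on a grid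
   gives k <= (1 + d/r)^nx as m grows. *)
Require Import Defs.
From HB Require Import structures.
From mathcomp Require Import all_boot all_order all_algebra.
From mathcomp Require Import all_classical all_reals all_analysis.
From mathcomp Require Import measurable_realfun ring lra.
Import Order.TTheory GRing.Theory Num.Theory.
Import numFieldNormedType.Exports.
Local Open Scope classical_set_scope.
Local Open Scope ring_scope.
Set Implicit Arguments.
Unset Strict Implicit.
Unset Printing Implicit Defensive.

(** * Hoeffding's inequality *)

(** Used for inequalities on the half-line: it reduces nonnegativity to the value at 0 and the sign
    of a derivative. *)
Lemma is_derive_ge0_le0x (R : realType) (f f' : R -> R) :
  (forall u, is_derive u (1 : R) f (f' u)) -> (forall u, 0 <= u -> 0 <= f' u) ->
  forall u, 0 <= u -> f 0 <= f u.
Proof.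
move=> df f'0 u u0.
have dfx x : derivable f x 1 by have [] := df x.
apply: (@ger0_derive1_ndecry _ f 0) => //.
- move=> x; rewrite in_itv/= andbT => x0.
  by rewrite derive1E; have [_ ->] := df x; rewrite f'0// ltW.
- apply: continuous_subspaceT => x.
  by apply/differentiable_continuous/derivable1_diffP; exact: dfx.
Qed.

Section bernoulli_mgf.
Variables (R : realType) (p : R).
Hypothesis p01 : 0 <= p <= 1.

Let den (u : R) := 1 - p + p * expR u.

Let den_gt0 u : 0 < den u.
Proof.
rewrite /den; case/andP: p01 => p0 p1.
have [->|pN1] := eqVneq p 1; first by rewrite subrr add0r mul1r expR_gt0.
rewrite ltr_pwDl ?mulr_ge0 ?expR_ge0//.
by rewrite subr_gt0 lt_neqAle pN1.
Qed.

(** The function [f], the exponent minus the logarithm of the left side, vanishes at 0 together with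
    its derivative [f1]. Writing w for the tilted weight [p * expR v / den v], its second derivative
    is 1/4 - w (1 - w) = (w - 1/2)^2, which is nonnegative. *)
Lemma bernoulli_mgf_le u : 0 <= u ->
  1 - p + p * expR u <= expR (p * u + u ^+ 2 / 8).
Proof.
move=> u0; rewrite -ler_ln ?posrE ?expR_gt0//; last exact: den_gt0.
rewrite expRK -subr_ge0.
pose f1 v := v / 4 + p - p * expR v / den v.
have f1_ge0 v : 0 <= v -> 0 <= f1 v.
  have f10 : f1 0 = 0.
    by rewrite /f1 /den expR0 mulr1 subrK mul0r add0r divr1 subrr.
  move=> v0; rewrite -[leLHS]f10; apply: (@is_derive_ge0_le0x _ f1
    (fun w => (p * expR w / den w - 2^-1) ^+ 2)) => [w|w _|].
  - have dn0 : den w != 0 by rewrite gt_eqF.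
    apply: is_derive_eq.
    by rewrite /GRing.scale/=; field; rewrite dn0.
  - exact: sqr_ge0.
  - exact: v0.
pose f (v : R) : R := p * v + v ^+ 2 / 8 - ln (den v).
have f0 : f 0 = 0.
  by rewrite /f /den expR0 mulr1 subrK ln1 mulr0 expr0n mul0r subr0 addr0.
rewrite -[leLHS]f0; apply: (@is_derive_ge0_le0x _ f f1) => [v||];
  [|exact: f1_ge0|exact: u0].
have dv0 := den_gt0 v.
(* The quadratic part is differentiated next to an abstract [L]; the logarithm enters only through
   [dL]. *)
have dF (L : R -> R) d : is_derive v (1 : R) L d ->
    is_derive v (1 : R) (fun w => p * w + w ^+ 2 / 8 - L w) (v / 4 + p - d).
  move=> dL; apply: is_derive_eq.
  by rewrite /GRing.scale/=; field.
have dL : is_derive v (1 : R) (fun w => ln (den w)) ((den v)^-1 * (p * expR v)).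
  apply: is_derive1_comp; first exact: is_derive1_ln.
  by rewrite /den; apply: is_derive_eq; rewrite /GRing.scale/=; ring.
have := dF _ _ dL.
by rewrite [_^-1 * _]mulrC.
Qed.

End bernoulli_mgf.

(** Convexity of the exponential on [0, v]: the gap to the chord vanishes at v = 0 and grows with v,
    because l v <= v. *)
Lemma expR_chord_le (R : realType) (l v : R) : 0 <= l <= 1 -> 0 <= v ->
  expR (l * v) <= 1 - l + l * expR v.
Proof.
case/andP=> l0 l1 v0; rewrite -subr_ge0.
pose f (w : R) : R := 1 - l + l * expR w - expR (l * w).
have f0 : f 0 = 0 by rewrite /f mulr0 expR0 mulr1 subrK subrr.
rewrite -[leLHS]f0.
apply: (@is_derive_ge0_le0x _ f (fun w => l * (expR w - expR (l * w)))) v0.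
- move=> w; rewrite /f.
  apply: is_derive_eq; rewrite /GRing.scale/=; ring.
- move=> w w0; rewrite mulr_ge0// subr_ge0 ler_expR.
  by rewrite ler_piMl.
Qed.

Section hoeffding.
Context d (T : measurableType d) (R : realType) (P : probability T R).

Lemma itv_bounded_integrable (f : T -> R) (a b : R) :
  measurable_fun setT f -> (forall t, a <= f t <= b) ->
  P.-integrable setT (EFin \o f).
Proof.
move=> mf fab; apply: measurable_bounded_integrable => //.
  by rewrite (le_lt_trans (probability_le1 P _)) ?ltry.
exists (`|a| + `|b|); split; first by rewrite num_real.
move=> M ltM t _ /=; apply/ltW; apply: le_lt_trans ltM.
have /andP[aft ftb] := fab t.
rewrite ler_norml; apply/andP; split.
  rewrite lerNl (le_trans (y := - a)) ?lerN2// (le_trans (ler_norm _))//.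
  by rewrite normrN lerDl.
by rewrite (le_trans ftb)// (le_trans (ler_norm _))// lerDr.
Qed.

Lemma integrable_probability_cst (r : R) : P.-integrable setT (EFin \o cst r).
Proof. by apply: (@itv_bounded_integrable _ r r) => // t /=; rewrite lexx. Qed.

Lemma Rintegral_probability_cst (r : R) : \int[P]_t r = r.
Proof.
rewrite Rintegral_cst// [X in fine X](_ : _ = 1%E) ?mulr1//.
exact: probability_setT.
Qed.

Variables (h : T -> R) (a c : R).
Hypotheses (mh : measurable_fun setT h) (c0 : 0 < c).
Hypothesis hac : forall t, a <= h t <= a + c.

Let inth : P.-integrable setT (EFin \o h).
Proof. exact: itv_bounded_integrable hac. Qed.

(** The chord over [a, a + c] bounds [expR (s * h t)] by the function [k], which is affine in [h t].
    Integrating replaces [h] by its mean [m], and what remains is the moment generating function of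
    a Bernoulli variable of parameter (m - a) / c. *)
Lemma hoeffding_lemma (s : R) : 0 <= s ->
  (\int[P]_t (expR (s * h t))%:E <=
   (expR (s * \int[P]_t h t + s ^+ 2 * c ^+ 2 / 8))%:E)%E.
Proof.
move=> s0; set m := \int[P]_t h t.
have c_neq0 : c != 0 by rewrite gt_eqF.
have am : a <= m.
  rewrite -(Rintegral_probability_cst a); apply:
    (le_Rintegral _ (integrable_probability_cst a) inth) => // t _.
  by have /andP[] := hac t.
have mac : m <= a + c.
  rewrite -[leRHS]Rintegral_probability_cst; apply:
    (le_Rintegral _ inth (integrable_probability_cst _)) => // t _.
  by have /andP[] := hac t.
pose A := expR (s * a); pose B := expR (s * c).
pose k t := A * (1 - a / c * (B - 1)) + (A / c * (B - 1)) * h t.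
have hk t : expR (s * h t) <= k t.
  have /andP[aht hta] := hac t.
  have l01 : 0 <= (h t - a) / c <= 1.
    rewrite divr_ge0 ?subr_ge0 ?(ltW c0)//= ler_pdivrMr// mul1r.
    by rewrite lerBlDl.
  have := expR_chord_le l01 (mulr_ge0 s0 (ltW c0)).
  rewrite -/B => le.
  have -> : s * h t = s * a + (h t - a) / c * (s * c) by field.
  rewrite expRD -/A (le_trans (ler_wpM2l (expR_ge0 _) le))//.
  by rewrite -/A /k le_eqVlt; apply/orP; left; apply/eqP; field.
have mexp : measurable_fun setT (fun t => expR (s * h t)).
  by apply: measurableT_comp => //; exact: measurable_funM.
have intkh : P.-integrable setT (EFin \o (fun t => (A / c * (B - 1)) * h t)).
  apply: (@eq_integrable _ _ _ _ _ _
    (fun t => (A / c * (B - 1))%:E * (EFin \o h) t)%E) => //.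
  exact: integrableZl.
have intk : P.-integrable setT (EFin \o k).
  exact: (integrableD measurableT
    (integrable_probability_cst (A * (1 - a / c * (B - 1)))) intkh).
apply: (@le_trans _ _ (\int[P]_t (k t)%:E)%E).
  apply: ge0_le_integral => //.
  - exact/measurable_EFinP.
  - by case/integrableP : intk.
  - by move=> t _; rewrite lee_fin.
have -> : (\int[P]_t (k t)%:E = (\int[P]_t k t)%:E)%E.
  by rewrite /Rintegral fineK//; exact: integrable_fin_num.
rewrite lee_fin /k RintegralD//; last exact: integrable_probability_cst.
rewrite Rintegral_probability_cst RintegralZl//.
have p01 : 0 <= (m - a) / c <= 1.
  rewrite divr_ge0 ?subr_ge0 ?(ltW c0)//= ler_pdivrMr// mul1r.
  by rewrite lerBlDl.
have := bernoulli_mgf_le p01 (mulr_ge0 s0 (ltW c0)).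
rewrite -/B => le.
have -> : s * m + s ^+ 2 * c ^+ 2 / 8
  = s * a + ((m - a) / c * (s * c) + (s * c) ^+ 2 / 8) by field.
rewrite expRD -/A; apply: le_trans (ler_wpM2l (expR_ge0 _) le).
by rewrite -/A -/m le_eqVlt; apply/orP; left; apply/eqP; field.
Qed.

End hoeffding.

(** Independence in integrated form: the law of n + 1 samples is the image of a product measure
    under [tuple_cons], so Tonelli splits off the first factor. *)
Lemma integral_iid_prod d (T : measurableType d) (R : realType)
    (P : probability T R) (f : T -> R) (n : nat) :
  measurable_fun setT f -> (forall t, 0 <= f t) ->
  (\int[iid_law P n]_s (\prod_(i < n) f (tnth s i))%:E =
   (\int[P]_t (f t)%:E) ^+ n)%E.
Proof.
move=> mf f0.
have mprod k : measurable_fun [set: k.-tuple T]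
    (fun s => (\prod_(i < k) f (tnth s i))%:E).
  apply/measurable_EFinP; apply: measurable_prod => i _.
  by apply: measurableT_comp => //; exact: measurable_tnth.
elim: n => [|n IH].
  rewrite [LHS]integral_dirac//; last exact: (mprod 0).
  by rewrite diracT mul1e big_ord0.
rewrite [LHS]ge0_integral_distribution//; last 2 first.
- exact: (mprod n.+1).
- by move=> s; rewrite lee_fin prodr_ge0.
pose F (z : T * n.-tuple T) := (f z.1 * \prod_(i < n) f (tnth z.2 i))%:E.
rewrite (eq_integral F) => [|z _]; last first.
  rewrite /F /= big_ord_recl; congr (_ * _)%:E.
  by apply: eq_bigr => i _; rewrite tnthS.
have mF : measurable_fun setT F.
  apply/measurable_EFinP; apply: measurable_funM.
    exact: measurableT_comp.
  apply/measurable_EFinP.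
  exact: (measurableT_comp (mprod n) measurable_snd).
rewrite fubini_tonelli1//; last first.
  by move=> z; rewrite lee_fin mulr_ge0// prodr_ge0.
rewrite /fubini_F.
under eq_integral => t _.
  rewrite /F/=; under eq_integral do rewrite EFinM.
  rewrite ge0_integralZl//; last 2 first.
    by move=> s _; rewrite lee_fin prodr_ge0.
    by rewrite lee_fin.
  rewrite IH.
  over.
  exact: mprod.
rewrite [LHS]ge0_integralZr//; last 3 first.
- exact/measurable_EFinP.
- by move=> t _; rewrite lee_fin.
- by apply: expe_ge0; apply: integral_ge0 => t _; rewrite lee_fin.
- by rewrite expeS.
Qed.

Section hoeffding_tail.
Context d (T : measurableType d) (R : realType) (P : probability T R).
Variables (n : nat) (h : T -> R).
Hypothesis mh : measurable_fun setT h.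

Lemma measurable_sum_gt (b : R) :
  measurable [set s : n.-tuple T | b < \sum_(i < n) h (tnth s i)].
Proof.
rewrite -[X in measurable X]setTI.
apply: measurable_fun_ltr => //; apply: measurable_sum => i.
by apply: measurableT_comp => //; exact: measurable_tnth.
Qed.

(** Chernoff's method with [hoeffding_lemma]. The condition relating [y] and [t] is free of
    division, so a constant [h] with [c] = 0 is covered. *)
Lemma hoeffding_inequality (a c t y : R) :
  0 <= c -> (forall x, a <= h x <= a + c) -> 0 <= t ->
  c ^+ 2 * y <= 2 * n%:R * t ^+ 2 ->
  (iid_law P n [set s | (n%:R * (\int[P]_x h x + t) <
                         \sum_(i < n) h (tnth s i))%R] <= (expR (- y))%:E)%E.
Proof.
move=> c0 hac t0 cy; set m := \int[P]_x h x; set A := [set _ | _].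
have mA : measurable A by exact: measurable_sum_gt.
(* If [c] = 0 then [h] is constantly [a], and the strict inequality defining the event never
   holds. *)
move: c0; rewrite le_eqVlt => /predU1P[c0|c0].
  have ha x : h x = a.
    by apply/eqP; rewrite eq_le; have := hac x; rewrite -c0 addr0 andbC.
  have ma : m = a.
    rewrite /m; under eq_Rintegral do rewrite ha.
    exact: Rintegral_probability_cst.
  rewrite [A](_ : _ = set0) ?measure0 ?lee_fin ?expR_ge0//.
  rewrite -subset0 => s; rewrite /A/= ma.
  under eq_bigr do rewrite ha.
  rewrite sumr_const card_ord -[a *+ n]mulr_natl ltNge => /negP; apply.
  by rewrite ler_wpM2l// lerDl.
have c_neq0 : c != 0 by rewrite gt_eqF.
(* This [s] minimises - s n t + n s^2 c^2 / 8, with minimum - 2 n t^2 / c^2. *)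
pose s := 4 * t / c ^+ 2.
have s0 : 0 <= s by rewrite /s divr_ge0 ?mulr_ge0 ?exprn_ge0// ltW.
pose f x := expR (s * h x).
have mf : measurable_fun setT f.
  by apply: measurableT_comp => //; exact: measurable_funM.
have f0 x : 0 <= f x by exact: expR_ge0.
pose k := expR (- (s * (n%:R * (m + t)))).
have k0 : 0 <= k by exact: expR_ge0.
have kprod (w : n.-tuple T) : k * \prod_(i < n) f (tnth w i) =
    expR (s * (\sum_(i < n) h (tnth w i) - n%:R * (m + t))).
  rewrite /k /f -expR_sum -mulr_sumr -expRD; congr expR; ring.
have mprod : measurable_fun [set: n.-tuple T]
    (fun w => (\prod_(i < n) f (tnth w i))%:E).
  apply/measurable_EFinP; apply: measurable_prod => i _.
  by apply: measurableT_comp => //; exact: measurable_tnth.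
(* Markov's inequality: on [A] the product scaled by [k] is at least 1. *)
have AE : (iid_law P n A <=
    \int[iid_law P n]_w (k%:E * (\prod_(i < n) f (tnth w i))%:E))%E.
  rewrite -(setIT A) -integral_indic//.
  apply: ge0_le_integral => //.
  - exact/measurable_EFinP/measurable_indic.
  - by apply: emeasurable_funM.
  - move=> w _; rewrite -EFinM lee_fin kprod indicE.
    have [wA|_] := boolP (w \in A); last exact: expR_ge0.
    rewrite -[leLHS]expR0 ler_expR mulr_ge0// subr_ge0.
    by move: wA; rewrite inE => /ltW.
apply: (le_trans AE).
rewrite ge0_integralZl//; last by move=> w _; rewrite lee_fin prodr_ge0.
rewrite integral_iid_prod//.
have := hoeffding_lemma P mh c0 hac s0.
have : (0 <= \int[P]_x (f x)%:E)%E.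
  by apply: integral_ge0 => x _; rewrite lee_fin.
(* The two bounds exclude infinite values, so the n-th power can be compared in the reals. *)
rewrite -/f; case: (\int[P]_x (f x)%:E)%E => [M| |]//.
rewrite !lee_fin => M0 leM.
rewrite -EFin_expe -EFinM lee_fin.
apply: (le_trans (ler_wpM2l k0 (lerXn2r n _ _ leM))).
- by rewrite nnegrE.
- by rewrite nnegrE expR_ge0.
rewrite -expRM_natl /k -expRD ler_expR -/m.
have -> : - (s * (n%:R * (m + t))) + n%:R * (s * m + s ^+ 2 * c ^+ 2 / 8)
  = - (2 * n%:R * t ^+ 2 / c ^+ 2) by rewrite /s; field.
by rewrite lerN2 ler_pdivlMr ?exprn_gt0// mulrC.
Qed.

End hoeffding_tail.

(** * Nets in Euclidean space *)

Lemma expr_unbounded (R : realType) (a b : R) : 1 < a -> exists m, b < a ^+ m.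
Proof.
move=> a1.
have bernoulli m : 1 + m%:R * (a - 1) <= a ^+ m.
  elim: m => [|m IH]; first by rewrite mul0r addr0.
  rewrite exprS (le_trans _ (ler_wpM2l (ltW (lt_trans ltr01 a1)) IH))//.
  rewrite -subr_ge0 -natr1.
  have -> : a * (1 + m%:R * (a - 1)) - (1 + (m%:R + 1) * (a - 1)) =
    m%:R * (a - 1) ^+ 2 by ring.
  by rewrite mulr_ge0// sqr_ge0.
have a10 : 0 < a - 1 by rewrite subr_gt0.
exists (Num.truncn (b / (a - 1))).+1.
apply: lt_le_trans (bernoulli _).
by rewrite ltr_pwDl// -ler_pdivrMr// ltW// truncnS_gt.
Qed.

Section packing.
Variables (R : realType) (n : nat) (N : 'rV[R]_n -> R).
Hypothesis ND : forall u v, N (u + v) <= N u + N v.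
Hypothesis NZ : forall a v, N (a *: v) = `|a| * N v.
Hypothesis coord_le : forall (v : 'rV[R]_n) i, `|v 0 i| <= N v.
Hypothesis le_coord : forall v : 'rV[R]_n, N v <= \sum_(i < n) `|v 0 i|.

Definition separated (r : R) (I : finType) (f : I -> 'rV[R]_n) :=
  forall i j, i != j -> r < N (f i - f j).

Definition diameter_le (d : R) (I : finType) (f : I -> 'rV[R]_n) :=
  forall i j, N (f i - f j) <= d.

Let NN v : N (- v) = N v.
Proof. by rewrite -scaleN1r NZ normrN normr1 mul1r. Qed.

(* The points of the new family are the words of length m in the letters f i,
   read in base 1 + d / r. *)
Lemma packing_power (I : finType) (f : I -> 'rV[R]_n) (r d : R) (m : nat) :
  0 < r -> 0 <= d -> separated r f -> diameter_le d f ->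
  exists (J : finType) (g : J -> 'rV[R]_n),
    [/\ #|J| = (#|I| ^ m)%N, separated r g &
        diameter_le (r * ((1 + d / r) ^+ m - 1)) g].
Proof.
move=> r0 d0 sepf df; set l := 1 + d / r.
have l1 : 1 <= l by rewrite lerDl divr_ge0// ltW.
elim: m => [|m [J [g [cardJ sepg dg]]]].
  exists unit, (fun=> 0); split => [||[] []]; first by rewrite card_unit.
    by case; case.
  by rewrite subrr -(scale0r 0) NZ normr0 mul0r expr0 subrr mulr0.
have lm1 : 1 <= l ^+ m by rewrite exprn_ege1.
have lm0 : 0 <= l ^+ m by rewrite (le_trans ler01).
have gE i j i' j' : (l ^+ m *: f i + g j) - (l ^+ m *: f i' + g j') =
    l ^+ m *: (f i - f i') + (g j - g j').
  by rewrite scalerBr opprD addrACA.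
exists (I * J)%type, (fun z => l ^+ m *: f z.1 + g z.2); split.
- by rewrite card_prod cardJ expnS.
- move=> [i j] [i' j'] /= ij; rewrite gE.
  (* With equal leading letters the tails provide the separation. Otherwise the leading terms are
     more than l^m r apart, and the tails can undo at most r (l^m - 1) of this, which leaves more
     than r. *)
  have [ii|ii] := eqVneq i i'.
    rewrite ii subrr scaler0 add0r sepg//.
    by move: ij; rewrite ii xpair_eqE eqxx.
  set u := _ *: _; set v := g j - g j'.
  have Nu : l ^+ m * r < N u.
    by rewrite NZ ger0_norm// ltr_pM2l ?sepf// (lt_le_trans ltr01).
  have : N u <= N (u + v) + N v.
    by rewrite -(NN v) -{1}(addrK v u) ND.
  have := dg j j'; rewrite -/v.
  by lra.
- move=> [i j] [i' j'] /=; rewrite gE (le_trans (ND _ _))//.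
  rewrite NZ ger0_norm//.
  have := dg j j'; have := ler_wpM2l lm0 (df i i').
  (* Since r l = r + d, the diameter bound reproduces itself exactly. *)
  have -> : r * (l ^+ m.+1 - 1) = l ^+ m * d + r * (l ^+ m - 1).
    by rewrite exprS {1}/l; field; rewrite gt_eqF.
  by lra.
Qed.

(** On a grid of side r / (n + 1), two points in the same box differ by at most that side in each
    coordinate, hence by at most r in [N], so each box holds at most one point. Coordinates are
    shifted by [d] relative to a base point to lie in [0, 2 d]; the divisor n + 1 remains positive
    when n = 0. *)
Lemma grid_card_le (I : finType) (f : I -> 'rV[R]_n) (r d : R) :
  0 < r -> 0 <= d -> separated r f -> diameter_le d f ->
  #|I|%:R <= ((2 * n.+1)%:R * (1 + d / r)) ^+ n.
Proof.
move=> r0 d0 sepf df.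
have [i0 _|I0] := pickP I; last first.
  rewrite (eq_card0 I0) exprn_ge0// mulr_ge0// addr_ge0// divr_ge0//.
  exact: ltW.
pose e := r / n.+1%:R.
have e0 : 0 < e by rewrite divr_gt0.
pose x i k : R := (f i 0 k - f i0 0 k + d) / e.
have xE i k : 0 <= x i k <= 2 * d / e.
  have := le_trans (coord_le (f i - f i0) k) (df i i0).
  rewrite !mxE ler_norml => /andP[h1 h2].
  rewrite /x divr_ge0 ?(ltW e0)//=; last lra.
  by rewrite ler_pM2r ?invr_gt0//; lra.
pose M := (Num.truncn (2 * d / e)).
have trM i k : (Num.truncn (x i k) < M.+1)%N.
  by have /andP[_ xle] := xE i k; rewrite ltnS le_truncn.
pose F i : {ffun 'I_n -> 'I_M.+1} := [ffun k => Ordinal (trM i k)].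
have Finj : injective F.
  move=> i j FE; apply/eqP/negPn/negP => ij.
  have := sepf _ _ ij; apply/negP; rewrite -leNgt (le_trans (le_coord _))//.
  apply: (@le_trans _ _ (\sum_(k < n) e)).
    apply: ler_sum => k _.
    have tE : Num.truncn (x i k) = Num.truncn (x j k).
      by move/ffunP/(_ k) : FE; rewrite !ffunE => /(congr1 val).
    have /andP[xi _] := xE i k; have /andP[xj _] := xE j k.
    have /andP[] := truncn_itv xi; have /andP[] := truncn_itv xj.
    rewrite tE -natr1 => h1 h2 h3 h4.
    have -> : (f i - f j) 0 k = e * (x i k - x j k).
      by rewrite !mxE /x; field; rewrite gt_eqF.
    rewrite normrM gtr0_norm// ler_piMr ?(ltW e0)//.
    by rewrite ler_norml; apply/andP; split; lra.
  rewrite sumr_const card_ord -mulr_natr /e -mulrA ler_piMr ?(ltW r0)//.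
  by rewrite ler_pdivrMl// mulr1 ler_nat.
have := leq_card F Finj; rewrite card_ffun !card_ord -(ler_nat R) natrX.
move=> /le_trans; apply; rewrite lerXn2r ?nnegrE//.
  by rewrite mulr_ge0// addr_ge0// divr_ge0// ltW.
have : M%:R <= 2 * d / e.
  by rewrite truncn_le// divr_ge0 ?mulr_ge0// ltW.
have -> : 2 * d / e = (2 * n.+1)%:R * (d / r).
  by rewrite /e natrM; field; rewrite nat1r pnatr_eq0 andbT gt_eqF.
rewrite mulrDr mulr1 -natr1 => Mle.
by rewrite addrC lerD// ler1n.
Qed.

(* Packing m-letter words raises both sides to the power m up to a constant
   factor independent of m, so the crude grid count becomes sharp. *)
Lemma packing_card_le (I : finType) (f : I -> 'rV[R]_n) (r d : R) :
  0 < r -> 0 <= d -> separated r f -> diameter_le d f ->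
  #|I|%:R <= (1 + d / r) ^+ n.
Proof.
move=> r0 d0 sepf df; set l := 1 + d / r.
have l1 : 1 <= l by rewrite lerDl divr_ge0// ltW.
have l0 : 0 < l by rewrite (lt_le_trans ltr01).
rewrite leNgt; apply/negP => lI.
have lI1 : 1 < #|I|%:R / l ^+ n.
  by rewrite ltr_pdivlMr ?exprn_gt0// mul1r.
have [m] := expr_unbounded ((2 * n.+1)%:R ^+ n) lI1.
apply/negP; rewrite -leNgt.
have [J [g [cardJ sepg dg]]] := packing_power m r0 d0 sepf df.
rewrite expr_div_n -[_%:R ^+ m]natrX -cardJ ler_pdivrMr ?exprn_gt0//.
apply: (le_trans (grid_card_le r0 _ sepg dg)).
  by rewrite mulr_ge0 ?(ltW r0)// subr_ge0 exprn_ege1.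
(* For the diameter r (l^m - 1), one plus diameter over r is exactly l^m, so the powers of [l]
   cancel. *)
rewrite -/l exprAC -exprMn le_eqVlt; apply/orP; left; apply/eqP.
by congr ((_ * _) ^+ _); field; rewrite gt_eqF.
Qed.

(** A separated family of maximal size is a net, since a point farther than r from all its members
    could be adjoined. The packing bound makes the sizes bounded, so a maximum exists. *)
Lemma finite_net (X : set 'rV[R]_n) (r d : R) :
  0 < r -> 0 <= d -> (forall x y, X x -> X y -> N (x - y) <= d) ->
  exists k (f : 'I_k -> 'rV[R]_n),
    [/\ forall i, X (f i), forall x, X x -> exists i, N (x - f i) <= r &
        k%:R <= (1 + d / r) ^+ n].
Proof.
move=> r0 d0 dX.
pose S k (f : 'I_k -> 'rV[R]_n) := (forall i, X (f i)) /\ separated r f.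
have Sle k f : @S k f -> k%:R <= (1 + d / r) ^+ n.
  move=> [Xf sepf]; rewrite -{1}(card_ord k).
  by apply: packing_card_le sepf _ => // i j; exact: dX.
pose p k := `[< exists f, @S k f >].
have p0 : exists k, p k.
  by exists 0%N; apply/asboolP; exists (fun=> 0); split => -[].
have pub k : p k -> (k <= Num.truncn ((1 + d / r) ^+ n))%N.
  move=> /asboolP[f /Sle kle]; rewrite truncn_ge_nat//.
  by rewrite exprn_ge0// addr_ge0// divr_ge0// ltW.
case: (ex_maxnP p0 pub) => k /asboolP[f Sf] kmax.
exists k, f; split; [exact: Sf.1| |exact: Sle Sf].
move=> x Xx; apply: contrapT => /forallNP far.
suff /kmax : p k.+1 by rewrite ltnn.
apply/asboolP; exists (fun i => if unlift ord0 i is Some j then f j else x).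
split => [i|i j]; first by case: unliftP => // j _; exact: Sf.1.
case: unliftP => [i' ->|->]; case: unliftP => [j' ->|->].
- by move=> ij; apply: Sf.2; apply: contra_neq ij => ->.
- by move=> _; rewrite -NN opprB ltNge; exact/negP.
- by move=> _; rewrite ltNge; exact/negP.
- by rewrite eqxx.
Qed.

End packing.

(** * Cauchy-Schwarz, the triangle inequality and coordinate bounds for the 2-norm *)

Section euclidean_norm.
Variables (R : realType) (n : nat).
Implicit Types u v : 'rV[R]_n.

Lemma qnorm2E v : qnorm 2%:E v = Num.sqrt (\sum_(i < n) v 0 i ^+ 2).
Proof.
rewrite /qnorm powR12_sqrt; last by apply: sumr_ge0 => i _; exact: powR_ge0.
congr Num.sqrt; apply: eq_bigr => i _.
by rewrite powR_mulrn// real_normK// num_real.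
Qed.

Let ssq v := \sum_(i < n) v 0 i ^+ 2.

Let ssq_ge0 v : 0 <= ssq v.
Proof. by apply: sumr_ge0 => i _; exact: sqr_ge0. Qed.

(** Cauchy-Schwarz, by expanding the sum of the squares of b u_i - a v_i and dividing by 2 a b; if a
    b = 0, one of the vectors is zero. *)
Let dot_le u v :
  \sum_(i < n) u 0 i * v 0 i <= Num.sqrt (ssq u) * Num.sqrt (ssq v).
Proof.
set a := Num.sqrt (ssq u); set b := Num.sqrt (ssq v).
have a2 : a ^+ 2 = ssq u by rewrite sqr_sqrtr.
have b2 : b ^+ 2 = ssq v by rewrite sqr_sqrtr.
have [a0 b0] : 0 <= a /\ 0 <= b by rewrite !sqrtr_ge0.
have key : 2 * (a * b) * \sum_(i < n) u 0 i * v 0 i <= 2 * (a * b) * (a * b).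
  have : 0 <= \sum_(i < n) (b * u 0 i - a * v 0 i) ^+ 2.
    by apply: sumr_ge0 => i _; exact: sqr_ge0.
  rewrite (eq_bigr (fun i => b ^+ 2 * u 0 i ^+ 2 + a ^+ 2 * v 0 i ^+ 2
    - 2 * (a * b) * (u 0 i * v 0 i))); last by move=> i _; ring.
  rewrite big_split/= big_split/= sumrN -!mulr_sumr -/(ssq u) -/(ssq v).
  rewrite -a2 -b2 subr_ge0 => /le_trans; apply.
  by rewrite le_eqVlt; apply/orP; left; apply/eqP; ring.
have [ab|ab] := eqVneq (a * b) 0; last first.
  rewrite -(ler_pM2l (_ : 0 < 2 * (a * b)))// mulr_gt0//.
  by rewrite lt_neqAle eq_sym ab mulr_ge0.
rewrite ab; have /eqP := ab; rewrite mulf_eq0 => /orP[] /eqP c0.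
  have u0 i : u 0 i = 0.
    have : ssq u = 0 by rewrite -a2 c0 expr0n.
    move/eqP; rewrite psumr_eq0 => [/allP/(_ i)|j _]; last exact: sqr_ge0.
    by rewrite mem_index_enum sqrf_eq0 => /(_ isT) /eqP.
  by rewrite big1// => i _; rewrite u0 mul0r.
have v0 i : v 0 i = 0.
  have : ssq v = 0 by rewrite -b2 c0 expr0n.
  move/eqP; rewrite psumr_eq0 => [/allP/(_ i)|j _]; last exact: sqr_ge0.
  by rewrite mem_index_enum sqrf_eq0 => /(_ isT) /eqP.
by rewrite big1// => i _; rewrite v0 mulr0.
Qed.

Lemma qnorm2D u v : qnorm 2%:E (u + v) <= qnorm 2%:E u + qnorm 2%:E v.
Proof.
rewrite !qnorm2E -/(ssq u) -/(ssq v).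
set a := Num.sqrt (ssq u); set b := Num.sqrt (ssq v).
have ab0 : 0 <= a + b by rewrite addr_ge0// sqrtr_ge0.
rewrite -[leRHS](ger0_norm ab0) -sqrtr_sqr ler_sqrt ?sqr_ge0//.
rewrite (eq_bigr (fun i => u 0 i ^+ 2 + v 0 i ^+ 2 + 2 * (u 0 i * v 0 i)));
  last by move=> i _; rewrite mxE; ring.
rewrite big_split/= big_split/= -mulr_sumr -/(ssq u) -/(ssq v).
have -> : (a + b) ^+ 2 = a ^+ 2 + b ^+ 2 + 2 * (a * b) by ring.
by rewrite !sqr_sqrtr// lerD2l ler_pM2l// dot_le.
Qed.

Lemma qnorm2Z (a : R) v : qnorm 2%:E (a *: v) = `|a| * qnorm 2%:E v.
Proof.
rewrite !qnorm2E -sqrtr_sqr -sqrtrM ?sqr_ge0// mulr_sumr.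
by congr Num.sqrt; apply: eq_bigr => i _; rewrite mxE exprMn.
Qed.

Lemma coord_le_qnorm2 v i : `|v 0 i| <= qnorm 2%:E v.
Proof.
rewrite qnorm2E -sqrtr_sqr ler_sqrt; last first.
  by apply: sumr_ge0 => j _; exact: sqr_ge0.
rewrite (bigD1 i)//= lerDl.
by apply: sumr_ge0 => j _; exact: sqr_ge0.
Qed.

Lemma qnorm2_le_sum v : qnorm 2%:E v <= \sum_(i < n) `|v 0 i|.
Proof.
rewrite qnorm2E; set s := \sum_(i < n) `|v 0 i|.
have s0 : 0 <= s by apply: sumr_ge0.
rewrite -[leRHS](ger0_norm s0) -sqrtr_sqr ler_sqrt ?sqr_ge0//.
rewrite expr2 {2}/s mulr_sumr; apply: ler_sum => i _.
rewrite -real_normK ?num_real// expr2 ler_wpM2r//.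
by rewrite /s (bigD1 i)//= lerDl sumr_ge0.
Qed.

End euclidean_norm.

(** * Empirical frequencies and costs *)

Section finite_unions.
Context d (T : measurableType d) (R : realType) (P : probability T R).

Lemma union_bound (I : finType) (A : I -> set T) (e : R) :
  (forall i, measurable (A i)) -> (forall i, (P (A i) <= e%:E)%E) ->
  exists U, [/\ measurable U, forall i, A i `<=` U &
                (P U <= (#|I|%:R * e)%:E)%E].
Proof.
move=> mA Ae; exists (\big[setU/set0]_(i <- enum I) A i); split.
- exact: bigsetU_measurable.
- move=> i; rewrite -bigcup_seq => t Ait; exists i => //=.
  by rewrite mem_enum.
- rewrite cardE; elim: (enum I) => [|i r IH].
    by rewrite big_nil measure0 mul0r.
  rewrite big_cons (le_trans (measureU2 _ _ _))//.
    exact: bigsetU_measurable.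
  by rewrite /= -natr1 mulrDl mul1r addrC EFinD leeD.
Qed.

(** The infimum of the measures of measurable supersets is attained by intersecting supersets that
    are optimal up to 1 / (n + 1). *)
Lemma measurable_hull (A : set T) :
  exists H, [/\ measurable H, A `<=` H &
    forall B, measurable B -> A `<=` B -> (P H <= P B)%E].
Proof.
pose S : set (\bar R) := [set P B | B in [set B | measurable B /\ A `<=` B]].
have infS_ge0 : (0 <= ereal_inf S)%E.
  by apply: le_ereal_inf_tmp => _ [B _ <-]; exact: measure_ge0.
have infS_le1 : (ereal_inf S <= 1)%E.
  rewrite -(probability_setT P); apply: ereal_inf_lbound.
  by exists setT => //; split.
have infS_fin : ereal_inf S \is a fin_num.
  by rewrite ge0_fin_numE// (le_lt_trans infS_le1)// ltry.
have /choice[B HB] n : exists B, [/\ measurable B, A `<=` B &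
    (P B <= ereal_inf S + n.+1%:R^-1%:E)%E].
  have n0 : 0 < n.+1%:R^-1 :> R by rewrite invr_gt0.
  have [_ [B [mB AB] <-] /ltW PB] := lb_ereal_inf_adherent n0 infS_fin.
  by exists B.
have mcap : measurable (\bigcap_n B n).
  by apply: bigcap_measurable => // n _; have [] := HB n.
exists (\bigcap_n B n); split => //.
  by move=> t At n _; have [_ + _] := HB n; exact.
move=> C mC AC; apply: (@le_trans _ _ (ereal_inf S)); last first.
  by apply: ereal_inf_lbound; exists C.
apply/lee_addgt0Pr => e e0.
pose n := Num.truncn e^-1.
have [mB _ PB] := HB n.
apply: (@le_trans _ _ (P (B n))).
  by apply: le_measure; rewrite ?inE//; exact: bigcap_inf.
apply: (le_trans PB); rewrite leeD2l// lee_fin.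
by rewrite invf_ple ?posrE// ltW// truncnS_gt.
Qed.

End finite_unions.

(** * Measurability in the uncertain parameter at a fixed decision *)

Section sections.
Variables (R : realType) (m n : nat) (X : set 'rV[R]_m).
Variables (Theta D : set 'rV[R]_n) (Theta0 : Theta !=set0).
Variable ThetaD : Theta `<=` D.

(** A set in the trace sigma-algebra comes from a measurable set [C] of the full product; the
    section of [C] at [x] is Borel, and its preimage in [Theta] is the set sought. *)
Lemma measurable2_section (f : X -> D -> R) (x : X) : measurable2 f ->
  measurable_fun setT (fun t : borel_sub Theta0 => f x (Defs.incl ThetaD t)).
Proof.
move=> mf _ Y mY; rewrite setTI.
have [C mC CE] := mf _ mY.
have mCx := measurable_xsection (val x : borel_rV R m) mC.
exists (xsection C (val x)) => //.
rewrite setTI; apply/seteqP; split => t /=.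
  rewrite /xsection/= inE => Ct.
  have : [set z : X * D | Y (f z.1 z.2)] (x, Defs.incl ThetaD t) by rewrite -CE.
  by [].
move=> Yt; rewrite /xsection/= inE.
have : [set z : X * D | Y (f z.1 z.2)] (x, Defs.incl ThetaD t) by [].
by rewrite -CE => -[].
Qed.

Lemma min_constraint_le0 (Z : nat) (Z0 : (0 < Z)%N) (g : 'I_Z -> X -> D -> R)
    (x : X) (t : D) :
  min_constraint Z0 g x t <= 0 <-> exists h, g h x t <= 0.
Proof.
split=> [/bigmin_leP[gx|[h _ gx]]|[h gx]].
- by exists (Ordinal Z0).
- by exists h.
- by apply/bigmin_leP; right; exists h.
Qed.

Lemma measurable_min_constraint_le0 (Z : nat) (Z0 : (0 < Z)%N)
    (g : 'I_Z -> X -> D -> R) (x : X) : (forall h, measurable2 (g h)) ->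
  measurable [set t : borel_sub Theta0 |
    min_constraint Z0 g x (Defs.incl ThetaD t) <= 0].
Proof.
move=> mg; rewrite [X in measurable X](_ : _ = \bigcup_(h in [set: 'I_Z])
  [set t : borel_sub Theta0 | g h x (Defs.incl ThetaD t) <= 0]); last first.
  apply/seteqP; split => t /=.
    by move=> /min_constraint_le0[h gh]; exists h.
  by move=> [h _ gh]; apply/min_constraint_le0; exists h.
apply: fin_bigcup_measurable => // h _.
rewrite -[X in measurable X]setTI.
by apply: measurable_fun_ler => //; exact: measurable2_section.
Qed.

End sections.

(** * Empirical frequencies and costs along a sample whose points each lie in exactly one cell *)

Section cells.
Variables (R : realType) (n N K : nat) (Theta D : set 'rV[R]_n).
Variables (Theta0 : Theta !=set0) (Dj : 'I_K -> set 'rV[R]_n).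

Definition union_cells (S : {set 'I_K}) : set (borel_sub Theta0) :=
  [set t | exists2 j, j \in S & Dj j (point_of t)].

Variable s : N.-tuple (borel_sub Theta0).
Hypothesis cover : forall i, exists j, Dj j (point_of (tnth s i)).
Hypothesis disjoint : forall i j j',
  Dj j (point_of (tnth s i)) -> Dj j' (point_of (tnth s i)) -> j = j'.

Lemma sum_cells (b : 'I_N -> R) :
  \sum_(j < K) \sum_(i in cell Dj s j) b i = \sum_(i < N) b i.
Proof.
under eq_bigr do rewrite big_mkcond.
rewrite exchange_big/=; apply: eq_bigr => i _.
have [j ij] := cover i.
rewrite (bigD1 j)//= inE mem_set// big1 ?addr0// => j' j'j.
rewrite inE; case: ifPn => //; rewrite inE => ij'.
by move: j'j; rewrite (disjoint ij' ij) eqxx.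
Qed.

Lemma sum_phat (S : {set 'I_K}) :
  \sum_(j in S) phat Dj s j =
  N%:R^-1 * \sum_(i < N) \1_(union_cells S) (tnth s i).
Proof.
rewrite -sum_cells mulr_sumr big_mkcond/=; apply: eq_bigr => j _.
transitivity (N%:R^-1 * \sum_(i in cell Dj s j) (j \in S)%:R : R).
  rewrite sumr_const /phat mulrC.
  by case: (j \in S); rewrite ?mul0rn ?mulr0.
congr (_ * _); apply: eq_bigr => i; rewrite inE => /set_mem ij.
rewrite indicE; congr (nat_of_bool _)%:R; apply/idP/idP => [jS|].
  by apply/mem_set; exists j.
by move=> /set_mem[j' j'S ij']; rewrite (disjoint ij ij').
Qed.

(** Grouping the samples by cell turns the difference into a sum of terms [phi (that j)] minus [phi]
    at a sample of cell j, and the Lipschitz bound applies to each. *)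
Lemma cluster_error (ThetaD : Theta `<=` D) (q : \bar R) (L : R)
    (phi : D -> R) (that : 'I_K -> D) :
  (forall t1 t2 : D, `|phi t1 - phi t2| <= L * qnorm q (val t1 - val t2)) ->
  `|\sum_(j < K) phat Dj s j * phi (that j) -
    N%:R^-1 * \sum_(i < N) phi (Defs.incl ThetaD (tnth s i))|
  <= c3 q L Dj s that.
Proof.
move=> phiL.
have -> : \sum_(j < K) phat Dj s j * phi (that j) =
    N%:R^-1 * \sum_(j < K) \sum_(i in cell Dj s j) phi (that j).
  rewrite mulr_sumr; apply: eq_bigr => j _.
  by rewrite sumr_const /phat -[_ *+ _]mulr_natl; ring.
rewrite -sum_cells -mulrBr normrM ger0_norm ?invr_ge0//.
rewrite /c3 ler_wpM2l ?invr_ge0// -sumrB (le_trans (ler_norm_sum _ _ _))//.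
apply: ler_sum => j _; rewrite -sumrB (le_trans (ler_norm_sum _ _ _))//.
by apply: ler_sum => i _; exact: phiL.
Qed.

End cells.


(** * Exceptional sample sets for overlapping cells and for excessive frequencies *)

Section sample_events.
Variables (R : realType) (nx n N K : nat).
Variables (X : set 'rV[R]_nx) (Theta D : set 'rV[R]_n) (Theta0 : Theta !=set0).
Variables (ThetaD : Theta `<=` D) (P : probability (borel_sub Theta0) R).
Hypothesis N0 : (0 < N)%N.

Let N_gt0 : 0 < N%:R :> R.
Proof. by rewrite ltr0n. Qed.

(** All pairwise overlaps lie in one measurable null set [V], and by independence almost surely no
    sample falls in [V]. Outside [U] the cells therefore act as a true partition of the sample. *)
Lemma samples_overlap_null (Dj : 'I_K -> set 'rV[R]_n) :
  (forall i j, i != j ->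
     P.-negligible [set t | (Dj i `&` Dj j) (point_of t)]) ->
  exists U : set (N.-tuple (borel_sub Theta0)),
    [/\ measurable U, iid_law P N U = 0 &
        forall s, ~ U s -> forall i j j', Dj j (point_of (tnth s i)) ->
          Dj j' (point_of (tnth s i)) -> j = j'].
Proof.
move=> disj.
have /choice[B HB] (z : 'I_K * 'I_K) : exists B : set (borel_sub Theta0),
    [/\ measurable B, (P B <= 0%:E)%E & z.1 != z.2 ->
        [set t | (Dj z.1 `&` Dj z.2) (point_of t)] `<=` B].
  (* Diagonal pairs carry no requirement and receive the empty set. *)
  have [zz|/disj[B [mB PB AB]]] := eqVneq z.1 z.2.
    by exists set0; rewrite measure0.
  by exists B; split => //; rewrite PB.
have mB z : measurable (B z) by have [] := HB z.
have PB z : (P (B z) <= 0%:E)%E by have [] := HB z.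
have [V [mV BV]] := union_bound mB PB.
rewrite mulr0 measure_le0 => /eqP PV.
pose G : set (N.-tuple (borel_sub Theta0)) :=
  [set s | forall i, (~` V) (tnth s i)].
have mG : measurable G.
  rewrite [G](_ : _ = \bigcap_(i in [set: 'I_N])
      ((@tnth N _)^~ i @^-1` (~` V))).
    apply: fin_bigcap_measurable => // i _.
    rewrite -[X in measurable X]setTI; apply: measurable_tnth => //.
    exact: measurableC.
  by apply/seteqP; split => s /= h i; [move=> _; exact: h|exact: h].
exists (~` G); split; first exact: measurableC.
- rewrite probability_setC//.
  have -> : iid_law P N G = 1%E.
    rewrite (@iid_lawE _ _ _ P N (fun=> ~` V)); last first.
      by move=> _; exact: measurableC.
    by rewrite big1// => i _; rewrite probability_setC// PV sube0.
  by rewrite subee.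
- move=> s /contrapT Gs i j j' ij ij'; apply/eqP/negPn/negP => jj'.
  have [_ _ /(_ jj')] := HB (j, j').
  by move=> /(_ (tnth s i) (conj ij ij')) /BV; exact: Gs.
Qed.

Lemma Rintegral_indic (H : set (borel_sub Theta0)) : measurable H ->
  \int[P]_t \1_H t = fine (P H).
Proof. by move=> mH; rewrite /Rintegral integral_indic// setIT. Qed.

(* Measurable hulls replace the cells, which are not assumed measurable. *)
Lemma frequency_le (Dj : 'I_K -> set 'rV[R]_n) (delta beta : R) :
  0 < delta -> 0 < beta ->
  N%:R >= (K%:R * ln 2 + ln (beta^-1)) / (2 * delta ^+ 2) ->
  exists U : set (N.-tuple (borel_sub Theta0)),
    [/\ measurable U, (iid_law P N U <= beta%:E)%E &
        forall s, ~ U s -> forall S B, measurable B ->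
          union_cells Dj S `<=` B ->
          N%:R^-1 * \sum_(i < N) \1_(union_cells Dj S) (tnth s i)
          <= fine (P B) + delta].
Proof.
move=> delta0 beta0 N_ge; set y := _ + _ in N_ge.
have /choice[H HH] S := measurable_hull P (union_cells (Theta0 := Theta0) Dj S).
have mH S : measurable (H S) by have [] := HH S.
pose A S : set (N.-tuple (borel_sub Theta0)) :=
  [set s | N%:R * (\int[P]_t \1_(H S) t + delta) <
           \sum_(i < N) \1_(H S) (tnth s i)].
have mA S : measurable (A S) by exact: measurable_sum_gt.
have PA S : (iid_law P N (A S) <= (expR (- y))%:E)%E.
  apply: (@hoeffding_inequality _ _ _ _ _ _ _ 0 1) => //; last 2 first.
  - exact: ltW.
  - move: N_ge; rewrite ler_pdivrMr ?mulr_gt0 ?exprn_gt0// expr1n mul1r.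
    by rewrite mulrCA mulrA.
  - by move=> t; rewrite add0r indicE; case: (_ \in _); rewrite ?lexx ?ler01.
have [U [mU AU PU]] := union_bound (P := iid_law P N) mA PA.
exists U; split => //.
  apply: (le_trans PU).
  (* There are 2^K unions and exp(- y) = beta / 2^K, so the total is exactly [beta]. *)
  rewrite lee_fin -cardsT -powersetT card_powerset cardsT card_ord.
  rewrite /y opprD expRD lnV ?posrE// opprK lnK ?posrE// -mulrN expRM_natl.
  by rewrite expRN lnK ?posrE// natrX mulrA -exprMn divff ?expr1n ?mul1r//.
move=> s Us S B mB SB.
have : ~ A S s by move=> /AU.
move=> /negP; rewrite -leNgt Rintegral_indic// => le.
apply: (@le_trans _ _ (N%:R^-1 * \sum_(i < N) \1_(H S) (tnth s i))).
  rewrite ler_wpM2l ?invr_ge0//; apply: ler_sum => i _.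
  have [_ SH _] := HH S.
  rewrite !indicE ler_nat; case: (boolP (_ \in union_cells Dj S)) => //.
  by move=> /set_mem/SH/mem_set ->.
(* Minimality of the hull gives P (H S) <= P B for every measurable [B] containing the union. *)
rewrite ler_pdivrMl// (le_trans le)// ler_wpM2l// lerD2r fine_le//.
- by rewrite fin_num_measure.
- by rewrite fin_num_measure.
- by have [_ _] := HH S; exact.
Qed.

End sample_events.

(** * Deviation of the empirical cost from its mean, uniformly over the decisions *)

Section uniform_deviation.
Variables (R : realType) (nx n N : nat).
Variables (X : set 'rV[R]_nx) (Theta D : set 'rV[R]_n) (Theta0 : Theta !=set0).
Variables (ThetaD : Theta `<=` D) (P : probability (borel_sub Theta0) R).
Variables (J : X -> D -> R) (J_ge0 : forall x t, 0 <= J x t).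
Hypothesis (mJ : measurable2 J) (N0 : (0 < N)%N).
Variables (osc L : R).
Hypothesis J_osc : forall x t1 t2, J x t1 - J x t2 <= osc.
Hypothesis J_lip : forall (x1 x2 : X) t,
  `|J x1 t - J x2 t| <= L * qnorm 2%:E (val x1 - val x2).

Let cost x (t : borel_sub Theta0) := J x (Defs.incl ThetaD t).

Let mcost x : measurable_fun setT (cost x).
Proof. exact: measurable2_section. Qed.

Let N_gt0 : 0 < N%:R :> R.
Proof. by rewrite ltr0n. Qed.

Let osc_ge0 (x : X) : 0 <= osc.
Proof.
pose t := Defs.incl ThetaD (point : borel_sub Theta0).
by have := J_osc x t t; rewrite subrr.
Qed.

(** Hoeffding needs an enclosing interval of width [osc]: its left end is the infimum of the costs
    at [x], which exists because costs are nonnegative. *)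
Let cost_itv x : exists a, forall t, a <= cost x t <= a + osc.
Proof.
have hlb : has_lbound (range (cost x)) by exists 0 => _ [t _ <-]; exact: J_ge0.
exists (inf (range (cost x))) => t; apply/andP; split.
  by apply: ge_inf => //; exists t.
rewrite -lerBlDr; apply: lb_le_inf; first by exists (cost x t), t.
by move=> _ [t' _ <-]; rewrite lerBlDr -lerBlDl; exact: J_osc.
Qed.

Lemma integrable_cost x : P.-integrable setT (EFin \o cost x).
Proof. by have [a xa] := cost_itv x; exact: itv_bounded_integrable xa. Qed.

Let cost_tail x c y : 0 <= c -> osc ^+ 2 * y <= 2 * N%:R * c ^+ 2 ->
  (iid_law P N [set s | (N%:R * (\int[P]_t cost x t + c) <
     \sum_(i < N) cost x (tnth s i))%R] <= (expR (- y))%:E)%E.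
Proof.
move=> c0 yc; have [a xa] := cost_itv x.
by apply: hoeffding_inequality xa _ _ => //; exact: (osc_ge0 x).
Qed.

(** The lower tail of the cost, as the upper tail of its negative on the reflected interval. *)
Let Ncost_tail x c y : 0 <= c -> osc ^+ 2 * y <= 2 * N%:R * c ^+ 2 ->
  (iid_law P N [set s | (N%:R * (\int[P]_t (- cost x t) + c) <
     \sum_(i < N) - cost x (tnth s i))%R] <= (expR (- y))%:E)%E.
Proof.
move=> c0 yc; have [a xa] := cost_itv x.
apply: (@hoeffding_inequality _ _ _ _ _ (fun t => - cost x t) _ (- (a + osc))).
- exact: measurable_funN.
- exact: (osc_ge0 x).
- by move=> t; have := xa t; rewrite opprD addrNK !lerN2 -opprD lerN2 andbC.
- exact: c0.
- exact: yc.
Qed.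

Let mean_lip x x' e : (forall t, cost x t <= cost x' t + e) ->
  \int[P]_t cost x t <= \int[P]_t cost x' t + e.
Proof.
move=> xx'.
have inte := integrable_probability_cst P e.
have -> : \int[P]_t cost x' t + e = \int[P]_t (cost x' t + e).
  rewrite RintegralD//; last exact: integrable_cost.
  by rewrite Rintegral_probability_cst.
apply: le_Rintegral => //; first exact: integrable_cost.
exact: (integrableD measurableT (integrable_cost x') inte).
Qed.

(** Both tails are controlled at every net point, each at total price [beta]. Passing from [x] to a
    net point within r changes the empirical cost and the mean by at most L r each, whence the term
    2 L r. *)
Lemma uniform_deviation (beta d r c : R) : 0 < beta -> 0 < r <= d -> 0 <= L ->
  (forall x y, X x -> X y -> qnorm 2%:E (x - y) <= d) -> 0 <= c ->
  osc ^+ 2 * (ln beta^-1 + nx%:R * ln (3 * d / r)) <= 2 * N%:R * c ^+ 2 ->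
  exists U : set (N.-tuple (borel_sub Theta0)),
    [/\ measurable U, (iid_law P N U <= (2 * beta)%:E)%E &
        forall s, ~ U s -> forall x,
          `|N%:R^-1 * \sum_(i < N) cost x (tnth s i) - \int[P]_t cost x t|
          <= c + 2 * L * r].
Proof.
move=> beta0 /andP[r0 rd] L0 dX c0; set y := ln _ + _ => yc.
have d0 : 0 < d by exact: lt_le_trans rd.
have [k [f [Xf fnet kle]]] := finite_net (@qnorm2D R nx) (@qnorm2Z R nx)
  (@coord_le_qnorm2 R nx) (@qnorm2_le_sum R nx) r0 (ltW d0) dX.
(* The definition of [y] makes exp(- y) equal to beta (3 d / r)^-nx, and the net has at most (1 + d
   / r)^nx <= (3 d / r)^nx points since r <= d. *)
have k_le : k%:R * expR (- y) <= beta.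
  have dr0 : 0 < 3 * d / r by rewrite divr_gt0 ?mulr_gt0.
  rewrite /y opprD expRD lnV ?posrE// opprK lnK ?posrE// -mulrN expRM_natl.
  rewrite expRN lnK ?posrE// mulrCA ler_piMr ?(ltW beta0)//.
  rewrite exprVn ler_pdivrMr ?exprn_gt0// mul1r (le_trans kle)//.
  rewrite lerXn2r ?nnegrE ?(ltW dr0)//.
    by rewrite addr_ge0 ?divr_ge0 ?(ltW d0) ?(ltW r0).
  have : 1 <= d / r by rewrite ler_pdivlMr// mul1r.
  by rewrite -mulrA; lra.
pose x_ i : X := SigSub (mem_set (Xf i)).
pose A i : set (N.-tuple (borel_sub Theta0)) :=
  [set s | N%:R * (\int[P]_t cost (x_ i) t + c) <
           \sum_(j < N) cost (x_ i) (tnth s j)].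
have mA i : measurable (A i) by exact: measurable_sum_gt.
have [U [mU AU PU]] := union_bound (P := iid_law P N) mA
  (fun i => cost_tail (x_ i) c0 yc).
pose B i : set (N.-tuple (borel_sub Theta0)) :=
  [set s | N%:R * (\int[P]_t (- cost (x_ i) t) + c) <
           \sum_(j < N) - cost (x_ i) (tnth s j)].
have mB i : measurable (B i).
  apply: (measurable_sum_gt (h := fun t => - cost (x_ i) t)).
  exact: measurable_funN.
have [V [mV BV PV]] := union_bound (P := iid_law P N) mB
  (fun i => Ncost_tail (x_ i) c0 yc).
exists (U `|` V); split; first exact: measurableU.
  rewrite (le_trans (measureU2 _ _ _))// mulr_natl mulr2n EFinD.
  by rewrite leeD//; [apply: (le_trans PU)|apply: (le_trans PV)];
    rewrite card_ord lee_fin.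
move=> s /not_orP[Us Vs] x.
have [i xi] := fnet (val x) (set_mem (valP x)).
have lip t : `|cost x t - cost (x_ i) t| <= L * r.
  by rewrite (le_trans (J_lip _ _ _))// ler_wpM2l.
set e := L * r in lip.
have lip1 t : cost x t <= cost (x_ i) t + e.
  by have := lip t; rewrite ler_norml => /andP[]; lra.
have lip2 t : cost (x_ i) t <= cost x t + e.
  by have := lip t; rewrite ler_norml => /andP[]; lra.
have m1 := mean_lip lip1; have m2 := mean_lip lip2.
have emp_lip x1 x2 : (forall t, cost x1 t <= cost x2 t + e) ->
    N%:R^-1 * \sum_(j < N) cost x1 (tnth s j) <=
    N%:R^-1 * (\sum_(j < N) cost x2 (tnth s j)) + e.
  move=> le12; rewrite ler_pdivrMl// mulrDr mulVKf ?gt_eqF//.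
  apply: (@le_trans _ _ (\sum_(j < N) (cost x2 (tnth s j) + e))).
    exact: ler_sum.
  by rewrite big_split/= sumr_const card_ord mulr_natl.
have e1 := emp_lip _ _ lip1; have e2 := emp_lip _ _ lip2.
have u1 : N%:R^-1 * (\sum_(j < N) cost (x_ i) (tnth s j)) <=
    \int[P]_t cost (x_ i) t + c.
  by rewrite ler_pdivrMl// leNgt; apply/negP => /(AU i).
have u2 : \int[P]_t cost (x_ i) t - c <=
    N%:R^-1 * (\sum_(j < N) cost (x_ i) (tnth s j)).
  have : N%:R^-1 * (\sum_(j < N) - cost (x_ i) (tnth s j)) <=
      \int[P]_t (- cost (x_ i) t) + c.
    by rewrite ler_pdivrMl// leNgt; apply/negP => /(BV i).
  have -> : \int[P]_t (- cost (x_ i) t) = - \int[P]_t cost (x_ i) t.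
    under eq_Rintegral do rewrite -mulN1r.
    by rewrite RintegralZl ?mulN1r//; exact: integrable_cost.
  by rewrite sumrN mulrN; lra.
rewrite -mulrA -/e ler_norml; apply/andP; split; lra.
Qed.

End uniform_deviation.

(** The probability bound is stated for a measurable event [E] inside the event of interest: [that]
    is an arbitrary function of the sample, so the latter need not be measurable. *)
Theorem theorem2 (R : realType) (nx nt N K Z : nat)
  (N0 : (0 < N)%N) (K0 : (0 < K)%N) (Z0 : (0 < Z)%N)
  (q : \bar R) (q1 : (1 <= q)%E)
  (X : set 'rV[R]_nx) (Theta D : set 'rV[R]_nt)
  (Theta0 : Theta !=set0) (ThetaD : Theta `<=` D)
  (P : probability (borel_sub Theta0) R)
  (Dj : 'I_K -> set 'rV[R]_nt)
  (Dj_sub : forall j, Dj j `<=` D)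
  (Dj_neq0 : forall j, Dj j !=set0)
  (Dj_cover : \bigcup_(j in [set: 'I_K]) Dj j = D)
  (Dj_disj : forall i j, i != j ->
     P.-negligible [set t | (Dj i `&` Dj j) (point_of t)])
  (J : X -> D -> R) (J_ge0 : forall x t, 0 <= J x t) (mJ : measurable2 J)
  (g : 'I_Z -> X -> D -> R) (mg : forall h, measurable2 (g h))
  (that : N.-tuple (borel_sub Theta0) -> 'I_K -> D)
  (gamma : 'I_K -> 'I_Z -> X -> D -> R)
  (gamma_ge0 : forall j h x t, 0 <= gamma j h x t)
  (gammaP : forall s j h x (t : D), Dj j (val t) ->
     g h x (that s j) - g h x t <= gamma j h x (that s j))
  (eps delta beta : R)
  (eps01 : 0 <= eps < 1) (delta_eps : 0 < delta <= eps)
  (beta01 : 0 < beta <= 1)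
  (N_ge : N%:R >= (K%:R * ln 2 + ln (beta^-1)) / (2 * delta ^+ 2))
  (Lt Lx : R) (Lt0 : 0 < Lt) (Lx0 : 0 < Lx)
  (J_lip_t : forall x (t1 t2 : D),
     `|J x t1 - J x t2| <= Lt * qnorm q (val t1 - val t2))
  (J_lip_x : forall (x1 x2 : X) t,
     `|J x1 t - J x2 t| <= Lx * qnorm 2%:E (val x1 - val x2))
  (diam Rx r : R)
  (diamP : is_maximum (distances q D) diam)
  (RxP : is_maximum (distances 2%:E X) Rx)
  (r0R : 0 < r <= Rx) :
  let CP := CP_value ThetaD P J (min_constraint Z0 g) eps in
  let PP s := PP_value Dj J g (phat Dj s) (that s) (eps - delta) in
  let RP s := RP_value gamma J g (phat Dj s) (that s) (eps + delta) in
  let c s := c1 Lt diam beta Rx r nx N + c2 Lx r + c3 q Lt Dj s (that s) in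
  exists E : set (N.-tuple (borel_sub Theta0)),
    [/\ measurable E,
        E `<=` [set s | (RP s - (c s)%:E <= CP)%E /\
                        (CP <= PP s + (c s)%:E)%E] &
        (iid_law P N E >= (1 - 3 * beta)%:E)%E].
Proof.
move=> CP PP RP c.
case/andP: eps01 => eps0 eps1; case/andP: delta_eps => delta0 de.
case/andP: beta01 => beta0 beta1; have /andP[r0 rR] := r0R.
have N_gt0 : 0 < N%:R :> R by rewrite ltr0n.
have Rx0 : 0 < Rx by exact: lt_le_trans rR.
pose osc := Lt * diam; set y := ln beta^-1 + nx%:R * ln (3 * Rx / r).
have y0 : 0 <= y.
  rewrite addr_ge0 ?mulr_ge0// ln_ge0//; first by rewrite invf_ge1.
  by rewrite -mulrA; have : 1 <= Rx / r; [rewrite ler_pdivlMr ?mul1r|lra].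
have c1_ge0 : 0 <= c1 Lt diam beta Rx r nx N by exact: sqrtr_ge0.
(* The term [c1] is calibrated to make this an equality; [y0] ensures that the square root is taken
   of a nonnegative number. *)
have c1E : osc ^+ 2 * y <= 2 * N%:R * c1 Lt diam beta Rx r nx N ^+ 2.
  rewrite /c1 -/y sqr_sqrtr.
    rewrite /osc le_eqVlt; apply/orP; left; apply/eqP.
    by field; rewrite gt_eqF.
  by rewrite mulr_ge0// divr_ge0// -exprMn sqr_ge0.
have J_osc x t1 t2 : J x t1 - J x t2 <= osc.
  rewrite (le_trans (ler_norm _))// (le_trans (J_lip_t _ _ _))//.
  rewrite ler_wpM2l ?(ltW Lt0)//; apply: diamP.2.
  by exists (val t1), (val t2); split => //; exact: set_mem (valP _).
have X_diam x x' : X x -> X x' -> qnorm 2%:E (x - x') <= Rx.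
  by move=> Xx Xx'; apply: RxP.2; exists x, x'.
(* The three exceptional sets have probability 0, at most [beta] and at most 2 beta; [E] is the
   complement of their union. *)
have [U0 [mU0 PU0 U0P]] := samples_overlap_null N Dj_disj.
have [U1 [mU1 PU1 U1P]] := frequency_le P N0 Dj delta0 beta0 N_ge.
have [U2 [mU2 PU2 U2P]] := uniform_deviation ThetaD P J_ge0 mJ N0 J_osc J_lip_x
  beta0 r0R (ltW Lx0) X_diam c1_ge0 c1E.
pose U := U0 `|` (U1 `|` U2).
have mU : measurable U by apply: measurableU => //; exact: measurableU.
exists (~` U); split; first exact: measurableC; last first.
  rewrite probability_setC// EFinB leeB//.
  have PU0_le : (iid_law P N U0 <= 0)%E by rewrite PU0.
  apply: le_trans (measureU2 _ _ _) _ => //; first exact: measurableU.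
  have -> : 3 * beta = 0 + (beta + 2 * beta) by ring.
  rewrite !EFinD; apply: leeD PU0_le _.
  by apply: le_trans (measureU2 _ _ _) _ => //; exact: leeD PU1 PU2.
move=> s /not_orP[U0s /not_orP[U1s U2s]].
have disj := U0P s U0s.
have cover i : exists j, Dj j (point_of (tnth s i)).
  have : D (point_of (tnth s i)) by exact/ThetaD/set_mem/valP.
  by rewrite -Dj_cover => -[j _ ij]; exists j.
have freq S B : measurable B -> union_cells Dj S `<=` B ->
    \sum_(j in S) phat Dj s j <= fine (P B) + delta.
  by move=> mB SB; rewrite sum_phat//; exact: U1P.
have phat1 : \sum_(j < K) phat Dj s j = 1.
  have := sum_phat cover disj [set: 'I_K].
  under eq_bigl do rewrite inE.
  move=> ->; rewrite (eq_bigr (fun=> 1)) => [|i _].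
    by rewrite sumr_const card_ord mulVf ?gt_eqF.
  by rewrite indicE mem_set//; have [j ij] := cover i; exists j.
pose G x : set (borel_sub Theta0) :=
  [set t | min_constraint Z0 g x (Defs.incl ThetaD t) <= 0].
have mG x : measurable (G x) by exact: measurable_min_constraint_le0.
have PGfin B : measurable B -> P B = (fine (P B))%:E.
  by move=> mB; rewrite fineK// fin_num_measure.
pose v x := \sum_(j < K) phat Dj s j * J x (that s j).
pose EJ x := \int[P]_(t in setT) J x (Defs.incl ThetaD t).
have EJE x : 'E_P[fun t => J x (Defs.incl ThetaD t)]%E = (EJ x)%:E.
  rewrite unlock /EJ /Rintegral fineK//; apply: integrable_fin_num => //.
  exact: integrable_cost J_osc _.
(* The empirical cost at the samples themselves is the intermediate quantity: [c3] pays for moving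
   to the representatives, [c1] and [c2] for moving to the mean. *)
have vEJ x : `|v x - EJ x| <= c s.
  have h1 := cluster_error cover disj ThetaD (that s) (J_lip_t x).
  have h2 := U2P s U2s x.
  rewrite /c /c2 [leRHS]addrC; apply: (le_trans _ (lerD h1 h2)).
  by rewrite (le_trans _ (ler_normD _ _))// addrA subrK.
split.
(* An infeasible problem has value +oo, so it suffices to show that each point feasible for CP is
   feasible for RP and to compare the two objectives there. *)
- apply: le_ereal_inf_tmp => _ [x Gx <-]; rewrite EJE leeBlDr//.
  apply: (@le_trans _ _ (v x)%:E); last first.
    by rewrite -EFinD lee_fin; have := vEJ x; rewrite ler_norml => /andP[]; lra.
  apply: ereal_inf_lbound; exists x => //=.
  pose S := [set j |
    `[< exists h, g h x (that s j) <= gamma j h x (that s j) >]]%SET.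
  have -> : \sum_(j < K) phat Dj s j * `[< exists h, g h x (that s j) <=
      gamma j h x (that s j) >]%:R = \sum_(j in S) phat Dj s j.
    rewrite [RHS]big_mkcond; apply: eq_bigr => j _.
    by rewrite inE; case: ifP => _; rewrite ?mulr1 ?mulr0.
  (* If cell j is not in [S], every g_h at the representative exceeds gamma, so [gammaP] makes every
     g_h positive on the whole cell. Such cells lie in the violation set, of probability at most
     eps, and so have total frequency at most eps + delta. *)
  have SG : union_cells Dj (~: S)%SET `<=` ~` G x.
    move=> t [j /[!inE] /asboolP jS jt] /min_constraint_le0[h gh].
    apply: jS; exists h.
    have := @gammaP s j h x (Defs.incl ThetaD t) jt.
    by lra.
  have := freq _ _ (measurableC (mG x)) SG.
  rewrite probability_setC// PGfin// -EFinB/=.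
  move: Gx => /=; rewrite -/(G x) PGfin// lee_fin => Gx.
  have : \sum_(j in S) phat Dj s j + \sum_(j in ~: S) phat Dj s j = 1.
    rewrite -phat1 [RHS](bigID (mem S))/=; congr (_ + _).
    by apply: eq_bigl => j; rewrite inE.
  by lra.
(* Conversely, a point feasible for PP is feasible for CP: cells certified by a single h lie in
   [G x], and their total frequency, at least 1 - eps + delta, exceeds P (G x) by at most delta. *)
- rewrite -leeBlDr//; apply: le_ereal_inf_tmp => _ [x Sx <-].
  rewrite leeBlDr//.
  apply: (@le_trans _ _ (EJ x)%:E); last first.
    rewrite -EFinD lee_fin -/(v x); have := vEJ x; rewrite ler_norml => /andP[].
    by lra.
  rewrite -EJE; apply: ereal_inf_lbound; exists x => //=.
  pose S := [set j |
    `[< exists h, forall t : D, Dj j (val t) -> g h x t <= 0 >]]%SET.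
  have SE : \sum_(j < K) phat Dj s j * `[< exists h, forall t : D,
      Dj j (val t) -> g h x t <= 0 >]%:R = \sum_(j in S) phat Dj s j.
    rewrite [RHS]big_mkcond; apply: eq_bigr => j _.
    by rewrite inE; case: ifP => _; rewrite ?mulr1 ?mulr0.
  have SG : union_cells Dj S `<=` G x.
    move=> t [j + jt]; rewrite inE => /asboolP[h jS].
    by apply/min_constraint_le0; exists h; exact: jS.
  have := freq _ _ (mG x) SG.
  rewrite -/(G x) PGfin// lee_fin.
  by move: Sx => /=; rewrite SE; lra.
Qed.
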